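(* Let $X$ be a Banach space, $M$ a $\sigma$-bounded family of positive measures on a $\sigma$-algebra $\Sigma$ of subsets of a nonempty set $T$, and $\theta,\phi$ a pair of conjugate Young's functions. Then the Henstock-Orlicz space $\mathcal{H}^\theta(M,X)$ is complete with respect to $\|\cdot\|_{\theta,M}$.
   Context: $T\neq\emptyset$ is a set, $\Sigma$ a $\sigma$-algebra of subsets of $T$, $X$ a Banach space, $M$ a family of positive (countably additive, $[0,\infty]$-valued) measures on $\Sigma$. Write $M(E)=\sup_{\mu\in M}\mu(E)$ for $E\in\Sigma$. $M$ is $\sigma$-bounded: every $E\in\Sigma$ is a union of a pairwise disjoint sequence $E_i\in\Sigma$ with $M(E_i)<\infty$. A property holds $M$-a.e. if it holds outside a set $N\in\Sigma$ with $M(N)=0$. $\mathcal{S}_X(\Sigma)$ is the set of $X$-valued $\Sigma$-simple functions and $\mathcal{S}(\Sigma)$ the set of scalar $\Sigma$-simple functions. $f:T\to X$ is $M$-measurable if some sequence in $\mathcal{S}_X(\Sigma)$ converges to $f$ $M$-a.e. Functions equal $M$-a.e. are identified. Conjugate Young's functions: let $\chi:[0,\infty]\to[0,\infty]$ be nondecreasing and left continuous with $\chi(0)=0$; define $\xi(0)=0$, $\xi(v)=\sup\{u:\chi(u)<v\}$ (so if $\lim_{u\to\infty}\chi(u)=A<\infty$ then $\xi(v)=\infty$ for $v>A$); then $\theta(u)=\int_0^u\chi(t)\,dt$ and $\phi(v)=\int_0^v\xi(t)\,dt$. $H\int$ denotes the Henstock-Kurzweil integral; for nonnegative measurable functions it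 is the Lebesgue integral. For scalar measurable $g$, $M_\phi(g)=\sup_{\mu\in M}H\int_T\phi(|g|)\,d\mu$. For $M$-measurable $f:T\to X$, $$\|f\|_{\theta,M}=\sup_{\mu\in M}\ \sup\Big\{H\int_T\|fg\|\,d\mu:\ g\in\mathcal{S}(\Sigma),\ M_\phi(g)\le1\Big\}.$$ $\mathcal{H}^\theta(M,X)$ is the space of all $M$-measurable $f:T\to X$ with $\|f\|_{\theta,M}<\infty$. *)

(* Defs.v *)
From HB Require Import structures.
From mathcomp Require Import all_boot all_order all_algebra.
From mathcomp Require Import complex.
From mathcomp Require Import all_classical all_reals all_analysis.
From mathcomp Require Import measurable_realfun.

Set Implicit Arguments.
Unset Strict Implicit.
Unset Printing Implicit Defensive.

Import Order.TTheory GRing.Theory Num.Theory.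
Import numFieldNormedType.Exports.

Local Open Scope classical_set_scope.
Local Open Scope ring_scope.

(* A Banach space may be real or complex. Norms of a normed module over K take
   values in K, so [rnorm] reads them as elements of R. *)
Variant scalars := RealScalars | ComplexScalars.

Definition scalar_field (R : realType) (s : scalars) : numFieldType :=
  match s with
  | RealScalars => R
  | ComplexScalars => complex R
  end.

Definition scalar_re (R : realType) (s : scalars) : scalar_field R s -> R :=
  match s return scalar_field R s -> R with
  | RealScalars => fun x => x
  | ComplexScalars => fun z => complex.Re z
  end.

Definition rnorm (R : realType) (s : scalars)
    (V : normedZmodType (scalar_field R s)) (x : V) : R :=
  scalar_re `|x|.

Local Open Scope ereal_scope.

(* Supremum in [0, +oo]; adjoining 0 only matters for the empty set, for which
   [ereal_sup] would return -oo. *)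
Definition nnsup (R : realType) (A : set (\bar R)) : \bar R :=
  ereal_sup ([set 0] `|` A).

Section young_functions.
Context {R : realType}.
Implicit Types chi : \bar R -> \bar R.

(* A function on [0, +oo] is represented by a function on \bar R whose values
   at negative points are irrelevant. *)
Definition young_density chi : Prop :=
  [/\ chi 0 = 0,
      forall u, 0 <= u -> 0 <= chi u,
      forall u v, 0 <= u -> u <= v -> chi u <= chi v &
      forall u, 0 < u -> chi @ within [set t | t < u] (nbhs u) --> chi u].

Definition young_conj_density chi (v : \bar R) : \bar R :=
  if v == 0 then 0 else ereal_sup [set u | 0 <= u /\ chi u < v].

Definition young_primitive chi (u : \bar R) : \bar R :=
  \int[lebesgue_measure]_(t in [set t : R | 0 <= t%:E <= u]) chi t%:E.

Definition conjugate_young (theta phi : \bar R -> \bar R) : Prop :=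
  exists2 chi, young_density chi &
    forall u, 0 <= u ->
      theta u = young_primitive chi u /\
      phi u = young_primitive (young_conj_density chi) u.

End young_functions.

Section family_of_measures.
Context {d : measure_display} {T : measurableType d} {R : realType}.
Variable M : set {measure set T -> \bar R}.

Definition sup_measure (E : set T) : \bar R := nnsup [set mu E | mu in M].

Definition sigma_bounded : Prop :=
  forall E : set T, measurable E ->
    exists F : nat -> set T,
      [/\ forall i, measurable (F i), trivIset setT F, E = \bigcup_i F i &
          forall i, sup_measure (F i) < +oo].

Definition M_ae (P : T -> Prop) : Prop :=
  exists N : set T,
    [/\ measurable N, sup_measure N = 0 & forall t, ~ N t -> P t].

End family_of_measures.

Definition simple_function (d : measure_display) (T : measurableType d)
    (V : Type) (f : T -> V) : Prop :=
  finite_set (range f) /\ forall v, measurable (f @^-1` [set v]).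

Lemma rnorm_ge0 (R : realType) (s : scalars)
    (V : normedZmodType (scalar_field R s)) (x : V) : (0 <= rnorm x)%R.
Proof.
by rewrite /rnorm; case: s V x => V x; have := normr_ge0 x => //;
  rewrite lecE => /andP[].
Qed.

Section integral_null.
Import HBNNSimple.

Lemma integral_eq_off_null (d : measure_display) (T : measurableType d)
    (R : realType) (mu : {measure set T -> \bar R}) (N : set T)
    (F G : T -> \bar R) :
  measurable N -> mu N = 0 -> (forall t, 0 <= F t) -> (forall t, 0 <= G t) ->
  (forall t, ~ N t -> F t = G t) -> \int[mu]_t F t = \int[mu]_t G t.
Proof.
move=> mN N0.
wlog suff le_int : F G / (forall t, 0 <= F t) -> (forall t, 0 <= G t) ->
    (forall t, ~ N t -> F t = G t) -> \int[mu]_t F t <= \int[mu]_t G t.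
  move=> F0 G0 FG; apply/eqP; rewrite eq_le !le_int// => t Nt.
  by rewrite FG.
move=> F0 G0 FG; rewrite !ge0_integralTE//.
apply: ge_ereal_sup => _ [h /= hF <-].
pose k := proj_nnsfun h (measurableC mN).
suff -> : sintegral mu h = sintegral mu k.
  apply: ereal_sup_ubound; exists k => //= t.
  rewrite /k /= mindicE; case: (pselect (N t)) => Nt.
    by rewrite memNset ?mulr0//; exact.
  by rewrite mem_set// mulr1 -FG.
rewrite -!integralT_nnsfun//.
apply: ae_eq_integral => //.
- by apply/measurable_EFinP; exact: measurable_funP.
- by apply/measurable_EFinP; exact: measurable_funP.
exists N; split=> // t /= hk; apply: contrapT => Nt; apply: hk => _.
by rewrite mindicE mem_set// mulr1.
Qed.

End integral_null.

Section henstock_orlicz.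
Context {d : measure_display} {T : measurableType d} {R : realType}.
Context {s : scalars} {X : completeNormedModType (scalar_field R s)}.
Variables (phi : \bar R -> \bar R) (M : set {measure set T -> \bar R}).
Implicit Types (f : T -> X) (g : T -> scalar_field R s).

Definition M_measurable f : Prop :=
  exists h : nat -> T -> X,
    (forall n, simple_function (h n)) /\
    M_ae M (fun t => h n t @[n --> \oo] --> f t).

(* The integrands are nonnegative, so the Henstock-Kurzweil integral is the
   Lebesgue integral. An M-measurable f may fail to be Sigma-measurable on a
   set N of Sigma with M(N) = 0; the library integral of a nonnegative
   function, a supremum over the simple functions below it, is insensitive to
   the values on such an N. *)
Definition M_phi g : \bar R :=
  nnsup [set \int[mu]_t phi (rnorm (g t))%:E | mu in M].

Definition orlicz_norm f : \bar R :=
  nnsup [set nnsup [set \int[mu]_t (rnorm (g t *: f t))%:E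
                   | g in [set g | simple_function g /\ M_phi g <= 1]]
        | mu in M].

(* Functions are representatives of the elements of the space, whose norm does
   not depend on the choice of representative: see [orlicz_norm_ae]. *)
Definition henstock_orlicz_space : set (T -> X) :=
  [set f | M_measurable f /\ orlicz_norm f < +oo].

Lemma orlicz_norm_ae f1 f2 :
  M_ae M (fun t => f1 t = f2 t) -> orlicz_norm f1 = orlicz_norm f2.
Proof.
move=> [N [mN N0 f12]]; rewrite /orlicz_norm; congr nnsup.
apply: eq_imagel => mu Mmu; congr nnsup; apply: eq_imagel => g _.
apply: (integral_eq_off_null mN).
- apply/eqP; rewrite eq_le measure_ge0 andbT -N0.
  by apply: ereal_sup_ubound; right; exists mu.
- by move=> t; rewrite lee_fin rnorm_ge0.
- by move=> t; rewrite lee_fin rnorm_ge0.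
- by move=> t /f12 ->.
Qed.

End henstock_orlicz.

Definition complete_wrt (R : realType) (V : zmodType) (S : set V)
    (p : V -> \bar R) : Prop :=
  forall u : nat -> V,
    (forall n, S (u n)) ->
    (forall e : R, (0 < e)%R -> exists N : nat, forall m n : nat,
       (N <= m)%N -> (N <= n)%N -> p (u m - u n)%R < e%:E) ->
    exists2 v : V, S v &
      forall e : R, (0 < e)%R -> exists N : nat, forall n : nat,
        (N <= n)%N -> p (u n - v)%R < e%:E.

(* Main.v *)
(* If [phi] is infinite on ]0, +oo[ the norm vanishes identically. Otherwise
   [phi c] tends to 0 with [c], so that a small multiple of the indicator of any
   [E] with [M(E) < +oo] is an admissible test function. A subsequence with
   summable successive distances then has a sum of pointwise norms which, by
   sigma-boundedness, is finite off a single set null for every measure of [M];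
   it converges there by completeness of X, and Fatou's lemma turns the
   pointwise limit into a limit for the norm. Representatives are first replaced
   by everywhere limits of simple functions, a class closed under pointwise
   limits. *)

Require Import Defs.
From mathcomp Require Import all_boot all_order all_algebra complex.
From mathcomp Require Import all_classical all_reals all_analysis.
From mathcomp Require Import measurable_realfun.

Set Implicit Arguments.
Unset Strict Implicit.
Unset Printing Implicit Defensive.

Import Order.TTheory GRing.Theory Num.Theory.
Import numFieldNormedType.Exports.

Local Open Scope classical_set_scope.
Local Open Scope ring_scope.

(** * Real-valued norms over real or complex scalars *)

Section real_valued_norm.
Context {R : realType} {s : scalars}.
Local Notation K := (scalar_field R s).

(** Right inverse of [scalar_re], and its inverse on nonnegative scalars. It reflects the order, so
    a norm inequality in [K] can be read off in [R]. *)
Definition scalar_of_real (r : R) : K :=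
  match s return scalar_field R s with
  | RealScalars => r
  | ComplexScalars => (r%:C)%C
  end.

Lemma ler_scalar_of_real (a b : R) :
  (scalar_of_real a <= scalar_of_real b) = (a <= b).
Proof. by rewrite /scalar_of_real; case: s => //; rewrite lecR. Qed.

Lemma ltr_scalar_of_real (a b : R) :
  (scalar_of_real a < scalar_of_real b) = (a < b).
Proof. by rewrite /scalar_of_real; case: s => //; rewrite ltcR. Qed.

Lemma scalar_of_real0 : scalar_of_real 0 = 0.
Proof. by rewrite /scalar_of_real; case: s. Qed.

Lemma scalar_of_realD (a b : R) :
  scalar_of_real (a + b) = scalar_of_real a + scalar_of_real b.
Proof. by rewrite /scalar_of_real; case: s => //; rewrite rmorphD. Qed.

Lemma scalar_of_realM (a b : R) :
  scalar_of_real (a * b) = scalar_of_real a * scalar_of_real b.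
Proof. by rewrite /scalar_of_real; case: s => //; rewrite rmorphM. Qed.

Lemma scalar_reK (x : K) : 0 <= x -> scalar_of_real (scalar_re x) = x.
Proof.
rewrite /scalar_of_real /scalar_re; case: s x => // -[a b].
by rewrite lecE /= => /andP[/eqP -> _].
Qed.

Lemma scalar_of_realK (a : R) : scalar_re (scalar_of_real a) = a.
Proof. by rewrite /scalar_of_real /scalar_re; case: s. Qed.

Lemma scalar_re_gt0 (x : K) : 0 < x -> 0 < scalar_re x.
Proof.
by move=> x0; rewrite -ltr_scalar_of_real scalar_reK ?ltW// scalar_of_real0.
Qed.

Lemma scalar_of_real_rnorm (V : normedZmodType K) (x : V) :
  scalar_of_real (rnorm x) = `|x|.
Proof. by rewrite /rnorm scalar_reK. Qed.

Lemma rnorm_scalar_of_real (a : R) : 0 <= a -> rnorm (scalar_of_real a) = a.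
Proof.
move=> a0; rewrite /rnorm ger0_norm ?scalar_of_realK//.
by rewrite -scalar_of_real0 ler_scalar_of_real.
Qed.

Lemma rnorm0 (V : normedZmodType K) : rnorm (0 : V) = 0.
Proof. by rewrite /rnorm normr0 -scalar_of_real0 scalar_of_realK. Qed.

Lemma rnorm_gt0 (V : normedZmodType K) (x : V) : x != 0 -> 0 < rnorm x.
Proof. by rewrite -normr_gt0 => /scalar_re_gt0. Qed.

Lemma rnormD (V : normedZmodType K) (x y : V) :
  rnorm (x + y) <= rnorm x + rnorm y.
Proof.
by rewrite -ler_scalar_of_real scalar_of_realD !scalar_of_real_rnorm ler_normD.
Qed.

Lemma rnormN (V : normedZmodType K) (x : V) : rnorm (- x) = rnorm x.
Proof. by rewrite /rnorm normrN. Qed.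

Lemma rnormBC (V : normedZmodType K) (x y : V) : rnorm (x - y) = rnorm (y - x).
Proof. by rewrite -opprB rnormN. Qed.

Lemma rnormZ (V : normedModType K) (a : K) (x : V) :
  rnorm (a *: x) = rnorm a * rnorm x.
Proof.
by rewrite -[LHS]scalar_of_realK scalar_of_real_rnorm normrZ
  -!scalar_of_real_rnorm -scalar_of_realM scalar_of_realK.
Qed.

Lemma ler_rnorm_dist (V : normedZmodType K) (x y : V) :
  `|rnorm x - rnorm y| <= rnorm (x - y).
Proof.
rewrite ler_norml; apply/andP; split.
  by rewrite lerNl opprB lerBlDr rnormBC -{1}(subrK x y) rnormD.
by rewrite lerBlDr -{1}(subrK y x) rnormD.
Qed.

(** A positive element of [K] is real even when [K] is complex, so real radii suffice to test
    convergence. *)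
Lemma cvg_rnormP (V : normedModType K) (x : nat -> V) (l : V) :
  x n @[n --> \oo] --> l <->
  forall e : R, 0 < e -> \forall n \near \oo, rnorm (x n - l) < e.
Proof.
split=> [/cvgrPdistC_lt xl e e0|xl].
  have : 0 < scalar_of_real e by rewrite -scalar_of_real0 ltr_scalar_of_real.
  move=> /xl; apply: filterS => n.
  by rewrite -scalar_of_real_rnorm ltr_scalar_of_real.
apply/cvgrPdistC_lt => e e0; have := xl _ (scalar_re_gt0 e0).
apply: filterS => n.
by rewrite -ltr_scalar_of_real scalar_of_real_rnorm scalar_reK ?ltW.
Qed.

Lemma cvg_rnorm (V : normedModType K) (x : nat -> V) (l : V) :
  x n @[n --> \oo] --> l -> rnorm (x n) @[n --> \oo] --> rnorm l.
Proof.
move=> /cvg_rnormP xl; apply/cvgrPdistC_lt => e /xl; apply: filterS => n.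
exact/le_lt_trans/ler_rnorm_dist.
Qed.

Lemma rnorm_cauchy_cvg (V : completeNormedModType K) (x : nat -> V) :
  (forall e : R, 0 < e -> exists N, forall m n, (N <= m)%N -> (m <= n)%N ->
     rnorm (x n - x m) < e) -> cvg (x n @[n --> \oo]).
Proof.
move=> xc; apply/cauchy_cvgP/cauchyP => e e0.
have [N hN] := xc _ (scalar_re_gt0 e0).
exists (x N); exists N => // n /= Nn.
rewrite -ball_normE /= distrC -scalar_of_real_rnorm -(scalar_reK (ltW e0)).
by rewrite ltr_scalar_of_real hN.
Qed.

(** By telescoping, the distance from [x m] to [x n] is at most the tail of the series from [m], and
    the tails tend to 0; hence the sequence is Cauchy. *)
Lemma rnorm_summable_cvg (V : completeNormedModType K) (x : nat -> V) :
  (\sum_(0 <= k <oo) (rnorm (x k.+1 - x k))%:E < +oo)%E ->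
  cvg (x n @[n --> \oo]).
Proof.
move=> xs; apply: rnorm_cauchy_cvg => e e0.
have := @nneseries_tail_cvg R (fun k => (rnorm (x k.+1 - x k))%:E) xpredT xs.
have r0 k : true -> (0 <= (rnorm (x k.+1 - x k))%:E)%E.
  by rewrite lee_fin rnorm_ge0.
move=> /(_ r0) /fine_cvgP[fin /cvgrPdistC_lt/(_ _ e0)].
move=> cv; have [N _ hN] := filterI fin cv.
exists N => m n Nm mn; have [/= tfin] := hN m Nm.
rewrite subr0; apply: le_lt_trans; apply: le_trans (ler_norm _).
rewrite -lee_fin fineK//.
apply: le_trans (nneseries_lim_ge n _); last by move=> k _; exact: r0.
rewrite sumEFin lee_fin -(subnKC mn); elim: (n - m)%N => [|k ih].
  by rewrite addn0 subrr rnorm0 big_geq.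
rewrite addnS big_nat_recr ?leq_addr//= addrC -(subrKA (x (m + k)%N)).
apply: le_trans (rnormD _ _) _; exact: lerD.
Qed.

End real_valued_norm.

(** * Operations on simple functions *)

Section simple_functions.
Context {d : measure_display} {T : measurableType d}.

Lemma simple_function_preimage (V : Type) (f : T -> V) (A : set V) :
  simple_function f -> measurable (f @^-1` A).
Proof.
move=> [ff mf].
rewrite (_ : _ @^-1` _ = \bigcup_(v in range f `&` A) (f @^-1` [set v])).
  apply: fin_bigcup_measurable => [|v _]; last exact: mf.
  exact: finite_setIl.
apply/seteqP; split=> [t At|t [v [_ Av] /= ->]]//.
by exists (f t) => //; split=> //; exists t.
Qed.

Lemma simple_function_comp (V W : Type) (f : T -> V) (q : V -> W) :
  simple_function f -> simple_function (q \o f).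
Proof.
move=> sf; split; last first.
  by move=> w; rewrite comp_preimage; exact: simple_function_preimage.
rewrite -(image_comp f q setT); apply: finite_image; by case: sf.
Qed.

(** Pairing reduces each pointwise binary operation to a single composition. *)
Lemma simple_function_pair (V W : Type) (f : T -> V) (g : T -> W) :
  simple_function f -> simple_function g -> simple_function (fun t => (f t, g t)).
Proof.
move=> [ff mf] [fg mg]; split.
  apply: sub_finite_set (finite_setX ff fg) => _ [t _ <-].
  by split; exists t.
move=> [v w]; rewrite (_ : _ @^-1` _ = f @^-1` [set v] `&` g @^-1` [set w]).
  exact: measurableI.
by apply/seteqP; split=> t /=; [case=> -> ->|case=> -> ->].
Qed.

Lemma simple_function_comp2 (V W Z : Type) (f : T -> V) (g : T -> W)
    (q : V -> W -> Z) : simple_function f -> simple_function g ->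
  simple_function (fun t => q (f t) (g t)).
Proof.
move=> sf sg.
exact: (simple_function_comp (fun p => q p.1 p.2) (simple_function_pair sf sg)).
Qed.

Lemma simple_function_cst (V : Type) (v : V) :
  simple_function (fun _ : T => v).
Proof.
split; first by apply: sub_finite_set (finite_set1 v) => _ [t _ <-].
move=> w; have [<-|vw] := pselect (v = w).
  by rewrite (_ : _ @^-1` _ = setT)//; apply/seteqP; split.
by rewrite (_ : _ @^-1` _ = set0)//; apply/seteqP; split=> // t /vw.
Qed.

Lemma simple_function_mem (A : set T) :
  measurable A -> simple_function (fun t => t \in A).
Proof.
move=> mA; split; first exact: finite_finset.
have AE : [set t | (t \in A) = true] = A.
  by apply/seteqP; split=> t /=; [move/set_mem|move/mem_set].
case; first by rewrite (_ : _ @^-1` _ = A).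
rewrite (_ : _ @^-1` _ = ~` A); first exact: measurableC.
by apply/seteqP; split=> t /=; [move=> /negP + /mem_set|move=> ?; rewrite memNset].
Qed.

Lemma simple_function_if (V : Type) (A : set T) (f g : T -> V) :
  measurable A -> simple_function f -> simple_function g ->
  simple_function (fun t => if t \in A then f t else g t).
Proof.
move=> /simple_function_mem sA sf sg.
exact: (simple_function_comp2 (fun (b : bool) p => if b then p.1 else p.2) sA
  (simple_function_pair sf sg)).
Qed.

End simple_functions.

(** * Everywhere limits of simple functions *)

Section strong_measurability.
Context {d : measure_display} {T : measurableType d} {R : realType}.
Context {s : scalars} {X : normedModType (scalar_field R s)}.
Implicit Types f g : T -> X.

(** The counterpart of [M_measurable] without exceptional set: norms of such functions are genuinely
    measurable, as additivity of the integral and Fatou's lemma require. *)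
Definition strongly_measurable f : Prop :=
  exists h : nat -> T -> X,
    (forall n, simple_function (h n)) /\
    forall t, h n t @[n --> \oo] --> f t.

Lemma simple_strongly_measurable f :
  simple_function f -> strongly_measurable f.
Proof. by move=> sf; exists (fun _ => f); split=> // t; exact: cvg_cst. Qed.

Lemma strongly_measurableB f g :
  strongly_measurable f -> strongly_measurable g ->
  strongly_measurable (f - g).
Proof.
move=> [hf [sf cf]] [hg [sg cg]]; exists (fun n t => hf n t - hg n t); split.
  by move=> n; exact: (simple_function_comp2 (fun x y => x - y)).
by move=> t; exact: cvgB.
Qed.

Lemma strongly_measurable_if (A : set T) f g : measurable A ->
  strongly_measurable f -> strongly_measurable g ->
  strongly_measurable (fun t => if t \in A then f t else g t).
Proof.
move=> mA [hf [sf cf]] [hg [sg cg]].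
exists (fun n t => if t \in A then hf n t else hg n t); split.
  by move=> n; exact: simple_function_if.
by move=> t; case: ifP.
Qed.

Lemma simple_function_measurable (V : Type) (f : T -> V) (q : V -> R) :
  simple_function f -> measurable_fun setT (q \o f).
Proof.
move=> sf _ B mB; rewrite setTI comp_preimage.
exact: simple_function_preimage.
Qed.

Lemma strongly_measurable_rnorm f :
  strongly_measurable f -> measurable_fun setT (fun t => rnorm (f t)).
Proof.
move=> [h [sh ch]]; apply: (@measurable_fun_cvg _ _ _ _ (fun n t => rnorm (h n t))).
  by move=> n; exact: simple_function_measurable.
by move=> t _; exact: cvg_rnorm.
Qed.

(** The approximating simple functions together take countably many values, and these come
    arbitrarily close to every [f t]. With the next lemma this characterizes strong measurability by
    separability of the range and measurability of distances. *)
Lemma strongly_measurable_dense_range f : strongly_measurable f ->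
  exists x : nat -> X, forall t (e : R), 0 < e ->
    exists j, rnorm (f t - x j) < e.
Proof.
move=> [h [sh ch]].
have cD : countable (\bigcup_n range (h n)).
  by apply: bigcup_countable => // n _; apply: finite_set_countable; case: (sh n).
have hD n t : (\bigcup_n range (h n)) (h n t) by exists n => //; exists t.
have [D0|[x]] := pfcard_geP cD.
  by exists (fun _ => 0) => t; have := hD 0%N t; rewrite D0.
exists x => t e e0; have /cvg_rnormP/(_ _ e0)[N _ hN] := ch t.
have [j _ xj] := @surj _ _ _ _ x _ (hD N t).
by exists j; rewrite xj rnormBC; apply: hN => /=.
Qed.

(* Values are chosen greedily among the points [x 0, ..., x n], keeping the one
   nearest to [f t]. *)
Lemma dense_range_strongly_measurable f (x : nat -> X) :
  (forall t (e : R), 0 < e -> exists j, rnorm (f t - x j) < e) ->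
  (forall y, measurable_fun setT (fun t => rnorm (f t - y))) ->
  strongly_measurable f.
Proof.
move=> xf mf.
pose a j t := rnorm (f t - x j).
pose h := fix h n t := match n with
  | 0 => x 0%N
  | m.+1 => if t \in [set t | a m.+1 t < rnorm (f t - h m t)] then x m.+1
            else h m t end.
have hP n : simple_function (h n) /\
    measurable_fun setT (fun t => rnorm (f t - h n t)).
  elim: n => [|n [sh mh]]; first by split; [exact: simple_function_cst|exact: mf].
  have mA : measurable [set t | a n.+1 t < rnorm (f t - h n t)].
    rewrite -[X in measurable X]setTI.
    exact: (measurable_fun_ltr (mf _) mh).
  split; first by apply: simple_function_if => //; exact: simple_function_cst.
  (* After the greedy update the distance to [f t] is the minimum of the old distance and the
     distance to the new point, so its measurability propagates. *)
  rewrite (_ : (fun t => _) = (a n.+1 \min (fun t => rnorm (f t - h n t)))).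
    apply: measurable_minr => //; exact: mf.
  apply/funext => t /=; rewrite /Num.min; case: ifPn => [/set_mem/= ->//|].
  by rewrite notin_setE /= => /negP/negbTE ->.
exists h; split=> [n|t]; first by case: (hP n).
have hle n j : (j <= n)%N -> rnorm (f t - h n t) <= a j t.
  elim: n => [|n ih]; first by rewrite leqn0 => /eqP ->.
  have [lt|ge] := ltP (a n.+1 t) (rnorm (f t - h n t)).
    rewrite /= mem_set// leq_eqVlt => /orP[/eqP -> //|]; rewrite ltnS.
    by move=> /ih; apply: le_trans; exact: ltW.
  rewrite /= memNset/=; last by apply/negP; rewrite -leNgt.
  by rewrite leq_eqVlt => /orP[/eqP -> //|]; rewrite ltnS.
apply/cvg_rnormP => e /(xf t)[j jt]; exists j => // n /= jn.
by rewrite rnormBC; apply: le_lt_trans jt; exact: hle.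
Qed.

(** The union of the countable sets attached to the [f_ n] approximates the range of the limit, and
    distances from the limit to fixed points are limits of measurable functions. *)
Lemma strongly_measurable_cvg (f_ : nat -> T -> X) f :
  (forall n, strongly_measurable (f_ n)) ->
  (forall t, f_ n t @[n --> \oo] --> f t) -> strongly_measurable f.
Proof.
move=> sf ff.
have /choice[x hx] : forall n, exists x : nat -> X, forall t (e : R), 0 < e ->
    exists j, rnorm (f_ n t - x j) < e.
  by move=> n; exact: strongly_measurable_dense_range.
(* A single sequence listing all the [x n j]; the default 0 merely adds a point, which is
   harmless. *)
pose y i := if unpickle i is Some p then x p.1 p.2 else 0.
apply: (@dense_range_strongly_measurable _ y) => [t e e0|z].
  have /cvg_rnormP/(_ _ (divr_gt0 e0 (ltr0Sn _ 1)))[n _ /(_ n (leqnn n))/= fn] := ff t.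
  have [j jn] := hx n t _ (divr_gt0 e0 (ltr0Sn _ 1)).
  exists (pickle (n, j)); rewrite /y pickleK -(subrKA (f_ n t)) (splitr e).
  by apply: le_lt_trans (rnormD _ _) _; rewrite ltrD// rnormBC.
apply: (@measurable_fun_cvg _ _ _ _ (fun n t => rnorm (f_ n t - z))).
  move=> n; apply: strongly_measurable_rnorm.
  apply: (strongly_measurableB (sf n)).
  exact/simple_strongly_measurable/simple_function_cst.
by move=> t _; apply: cvg_rnorm; apply: cvgB => //; exact: cvg_cst.
Qed.

End strong_measurability.

(** * Integrals of nonnegative functions *)

Section nonnegative_integrals.
Local Open Scope ereal_scope.
Context {d : measure_display} {T : measurableType d} {R : realType}.
Variable mu : {measure set T -> \bar R}.
Implicit Types (D : set T) (F G : T -> \bar R).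

(* No measurability is needed: the integral of a nonnegative function is a
   supremum over the simple functions below it. *)
Lemma ge0_le_integral_nomeas D F G :
  (forall t, D t -> 0 <= F t) -> (forall t, D t -> F t <= G t) ->
  \int[mu]_(t in D) F t <= \int[mu]_(t in D) G t.
Proof.
move=> F0 FG; rewrite !(integral_mkcond D).
have FG' t : (F \_ D) t <= (G \_ D) t.
  by rewrite /patch; case: ifPn => // /set_mem; exact: FG.
have F0' t : 0 <= (F \_ D) t.
  by rewrite /patch; case: ifPn => // /set_mem; exact: F0.
rewrite !ge0_integralTE//; last by move=> t; exact: le_trans (FG' t).
apply: le_ereal_sup => _ [h /= hF <-]; exists h => //= t.
exact: le_trans (FG' t).
Qed.

(** If [D] had positive measure, the constant [+oo] on [D], which lies below [F], would already have
    infinite integral. *)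
Lemma integral_pinfty_null D F : measurable D -> (forall t, 0 <= F t) ->
  (forall t, D t -> F t = +oo) -> \int[mu]_t F t < +oo -> mu D = 0.
Proof.
move=> mD F0 Foo; apply: contraTeq => D0; rewrite -leNgt.
have <- : \int[mu]_(t in D) cst +oo t = +oo.
  by rewrite integral_cst// gt0_mulye// lt_neqAle eq_sym D0 measure_ge0.
rewrite (integral_mkcond D); apply: ge0_le_integral_nomeas => t _.
  by rewrite /patch; case: ifPn => _ //=; exact: leey.
by rewrite /patch; case: ifPn => // /set_mem/Foo ->.
Qed.

Lemma fatou_le (f_ : nat -> T -> \bar R) F (K : nat) (c : \bar R) :
  (forall n, measurable_fun setT (f_ n)) -> (forall n t, 0 <= f_ n t) ->
  (forall t, f_ n t @[n --> \oo] --> F t) ->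
  (forall n, (K <= n)%N -> \int[mu]_t f_ n t <= c) -> \int[mu]_t F t <= c.
Proof.
move=> mf f0 fF fc.
have FE t : F t = limn_einf (f_ ^~ t).
  rewrite is_cvg_limn_einfE; last by apply/cvg_ex; exists (F t).
  by apply/esym/cvg_lim.
rewrite (eq_integral (fun t => limn_einf (f_ ^~ t)))//.
apply: le_trans (fatou mu measurableT mf (fun n t _ => f0 n t)) _.
rewrite limn_einf_lim; apply: lime_le; first exact: is_cvg_einfs.
(* The infimum over indices from [n] on is at most the term at [maxn n K], where the bound [c] is
   available. *)
apply: nearW => n; apply: (le_trans _ (fc (maxn n K) (leq_maxr _ _))).
by apply: ereal_inf_lbound; exists (maxn n K) => //=; exact: leq_maxl.
Qed.

End nonnegative_integrals.

(** * Behaviour of the conjugate Young function near 0 *)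

Section young.
Local Open Scope ereal_scope.
Context {R : realType}.
Variables (theta phi : \bar R -> \bar R).
Hypothesis thetaphi : conjugate_young theta phi.

Let itvE (c : R) : [set t : R | 0 <= t%:E <= c%:E] = [set` `[0%R, c]].
Proof. by apply/seteqP; split=> t /=; rewrite in_itv/= !lee_fin. Qed.

Lemma young_conj_density_ge0 (chi : \bar R -> \bar R) u :
  young_density chi -> 0 <= u -> 0 <= young_conj_density chi u.
Proof.
move=> [chi0 _ _ _] u0; rewrite /young_conj_density; case: eqVneq => // un0.
(* The point 0 belongs to the set defining the supremum, since [chi 0 = 0 < u]. *)
by apply: ereal_sup_ubound; split=> //; rewrite chi0 lt_neqAle eq_sym un0.
Qed.

Lemma young_conj_density_le (chi : \bar R -> \bar R) u v :
  young_density chi -> 0 <= u -> u <= v ->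
  young_conj_density chi u <= young_conj_density chi v.
Proof.
move=> chiP u0 uv; have v0 := le_trans u0 uv.
have [->|un0] := eqVneq u 0.
  by rewrite {1}/young_conj_density eqxx young_conj_density_ge0.
have vn0 : v != 0.
  by rewrite gt_eqF// (lt_le_trans _ uv)// lt_neqAle eq_sym un0.
rewrite /young_conj_density (negbTE un0) (negbTE vn0).
by apply: le_ereal_sup => w [w0 /lt_le_trans wu]; split=> //; exact: wu.
Qed.

Lemma young_ge0 u : 0 <= u -> 0 <= phi u.
Proof.
have [chi chiP /[apply] -[_ ->]] := thetaphi.
by apply: integral_ge0 => t /= /andP[t0 _]; exact: young_conj_density_ge0.
Qed.

Lemma young0 : phi 0 = 0.
Proof.
have [chi chiP /(_ 0 (lexx _))[_ ->]] := thetaphi.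
by rewrite /young_primitive itvE set_itv1 integral_set1.
Qed.

(** The density [xi] is nondecreasing. If it is finite at some [c > 0], it is bounded on [[0, c]]
    and its primitive is at most linear there; otherwise it is infinite on all of []0, +oo[]. *)
Lemma young_dichotomy :
  (forall c : R, (0 < c)%R -> phi c%:E = +oo) \/
  (forall e : R, (0 < e)%R -> exists2 c : R, (0 < c)%R & phi c%:E <= e%:E).
Proof.
have [chi chiP phiE] := thetaphi.
set xi := young_conj_density chi in phiE.
have xi0 t : (0 <= t)%R -> 0 <= xi t%:E.
  by move=> t0; exact: young_conj_density_ge0.
have [[c c0 xic]|nxi] := pselect (exists2 c : R, (0 < c)%R & xi c%:E < +oo).
  right=> e e0.
  have xifin : xi c%:E \is a fin_num by rewrite ge0_fin_numE// xi0// ltW.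
  set k := fine (xi c%:E).
  have k0 : (0 <= k)%R by rewrite fine_ge0// xi0// ltW.
  have k1 : (0 < k + 1)%R by rewrite ltr_wpDl.
  (* The first bound gives [xi <= k] on [[0, b]], the second gives [k * b <= e]; [k + 1] avoids
     division by zero. *)
  pose b := Num.min c (e / (k + 1))%R.
  have b0 : (0 < b)%R by rewrite lt_min c0 divr_gt0.
  exists b => //; have [|_ ->] := phiE b%:E; first by rewrite lee_fin ltW.
  rewrite /young_primitive itvE.
  apply: (@le_trans _ _ (\int[lebesgue_measure]_(t in `[0%R, b]) (cst k%:E) t)).
    apply: ge0_le_integral_nomeas => t /=; rewrite in_itv/= => /andP[t0 tb].
      exact: xi0.
    rewrite fineK//; apply: young_conj_density_le => //; rewrite lee_fin.
    by rewrite (le_trans tb)// ge_min lexx.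
  rewrite integral_cst//= lebesgue_measure_itv/= lte_fin b0 oppr0 adde0.
  rewrite lee_fin (@le_trans _ _ ((k + 1) * b)%R)//.
    by rewrite ler_wpM2r ?lerDl// ltW.
  by rewrite mulrC -ler_pdivlMr// ge_min lexx orbT.
left=> c c0; have [|_ ->] := phiE c%:E; first by rewrite lee_fin ltW.
apply/eqP; rewrite eq_le leey /= leNgt; apply/negP.
rewrite /young_primitive itvE integral_mkcond.
move=> phic.
(* The interval is open at 0 because [xi] vanishes there. A finite [phi c] would make this interval
   null, although its length is [c > 0]. *)
have xioo t : `]0%R, c]%classic t -> ((fun t => xi t%:E) \_ `[0%R, c]) t = +oo.
  move=> /= /[!in_itv]/= /andP[t0 tc]; rewrite patchE mem_set/=; last first.
    by rewrite in_itv/= ltW.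
  by apply/eqP; rewrite eq_le leey/= leNgt; apply/negP => xit; apply: nxi; exists t.
have p0 t : 0 <= ((fun t => xi t%:E) \_ `[0%R, c]) t.
  rewrite patchE; case: ifPn => // /set_mem/=; rewrite in_itv/= => /andP[t0 _].
  exact: xi0.
have /eqP : lebesgue_measure `]0%R, c]%classic = 0.
  exact: (@integral_pinfty_null _ _ R (@lebesgue_measure R) _ _
    (measurable_itv _) p0 xioo phic).
rewrite lebesgue_measure_itv/=.
by rewrite lte_fin c0 oppr0 adde0 eqe gt_eqF.
Qed.

End young.

(** * Null sets of a family of measures *)

Section family_of_measures_theory.
Local Open Scope ereal_scope.
Context {d : measure_display} {T : measurableType d} {R : realType}.
Variable M : set {measure set T -> \bar R}.

Lemma nnsup_le (A : set (\bar R)) c :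
  0 <= c -> (forall x, A x -> x <= c) -> nnsup A <= c.
Proof. by move=> c0 Ac; apply: ge_ereal_sup => x [->//|/Ac]. Qed.

Lemma le_nnsup (A : set (\bar R)) x : A x -> x <= nnsup A.
Proof. by move=> Ax; apply: ereal_sup_ubound; right. Qed.

Lemma nnsup_ge0 (A : set (\bar R)) : 0 <= nnsup A.
Proof. by apply: ereal_sup_ubound; left. Qed.

(** Reduces null sets of the supremum, which need not be a measure, to null sets of each member,
    where countable unions are covered by the usual theory. *)
Lemma sup_measure_eq0P (N : set T) :
  sup_measure M N = 0 <-> forall mu, M mu -> mu N = 0.
Proof.
split=> [N0 mu Mmu|N0].
  by apply/eqP; rewrite eq_le measure_ge0 andbT -N0; apply: le_nnsup; exists mu.
apply/eqP; rewrite eq_le nnsup_ge0 andbT.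
by apply: nnsup_le => // _ [mu Mmu <-]; rewrite N0.
Qed.

Lemma sup_measure_bigcup_eq0 (N : nat -> set T) :
  (forall n, measurable (N n)) -> (forall n, sup_measure M (N n) = 0) ->
  sup_measure M (\bigcup_n N n) = 0.
Proof.
move=> mN N0; apply/sup_measure_eq0P => mu Mmu.
apply/negligibleP; first exact: bigcupT_measurable.
apply: negligible_bigcup => n; apply/negligibleP => //.
by move: (N0 n) => /sup_measure_eq0P; exact.
Qed.

Lemma M_ae_and (P Q : T -> Prop) :
  M_ae M P -> M_ae M Q -> M_ae M (fun t => P t /\ Q t).
Proof.
move=> [A [mA /sup_measure_eq0P A0 PA]] [B [mB /sup_measure_eq0P B0 QB]].
exists (A `|` B); split; first exact: measurableU.
  apply/sup_measure_eq0P => mu Mmu.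
  by rewrite null_set_setU ?A0 ?B0.
by move=> t /not_orP[nA nB]; split; [exact: PA|exact: QB].
Qed.

Lemma M_ae_sub (P Q : T -> Prop) :
  (forall t, P t -> Q t) -> M_ae M P -> M_ae M Q.
Proof. by move=> PQ [N [mN N0 NP]]; exists N; split=> // t /NP/PQ. Qed.

End family_of_measures_theory.

(** * The Orlicz norm and almost everywhere convergence *)

Section orlicz_norm_theory.
Local Open Scope ereal_scope.
Context {d : measure_display} {T : measurableType d} {R : realType}.
Context {s : scalars} {X : completeNormedModType (scalar_field R s)}.
Variables (theta phi : \bar R -> \bar R) (M : set {measure set T -> \bar R}).
Hypothesis thetaphi : conjugate_young theta phi.
Implicit Types (f : T -> X) (g : T -> scalar_field R s).

Lemma orlicz_norm_ge0 f : 0 <= orlicz_norm phi M f.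
Proof. exact: nnsup_ge0. Qed.

Lemma le_orlicz_norm f g mu : M mu -> simple_function g -> M_phi phi M g <= 1 ->
  \int[mu]_t (rnorm (g t *: f t))%:E <= orlicz_norm phi M f.
Proof.
move=> Mmu sg g1; apply: (@le_trans _ _ (nnsup [set \int[mu]_t (rnorm (g t *: f t))%:E
  | g in [set g | simple_function g /\ M_phi phi M g <= 1]])).
  by apply: le_nnsup; exists g.
by apply: le_nnsup; exists mu.
Qed.

Lemma orlicz_norm_le f c : 0 <= c ->
  (forall g mu, M mu -> simple_function g -> M_phi phi M g <= 1 ->
    \int[mu]_t (rnorm (g t *: f t))%:E <= c) -> orlicz_norm phi M f <= c.
Proof.
move=> c0 fc; apply: nnsup_le => // _ [mu Mmu <-].
by apply: nnsup_le => // _ [g [sg g1] <-]; exact: fc.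
Qed.

Lemma orlicz_norm_cst0 : orlicz_norm phi M (fun=> 0%R : X) = 0.
Proof.
apply/eqP; rewrite eq_le orlicz_norm_ge0 andbT; apply: orlicz_norm_le => // g mu _ _ _.
by rewrite integral0_eq// => t _; rewrite scaler0 rnorm0.
Qed.

Lemma measurable_rnormZ f g : simple_function g -> strongly_measurable f ->
  measurable_fun setT (fun t => (rnorm (g t *: f t))%:E).
Proof.
move=> sg sf; apply/measurable_EFinP.
under eq_fun do rewrite rnormZ; apply: measurable_funM.
  exact: (simple_function_measurable (@rnorm R s _)).
exact: strongly_measurable_rnorm.
Qed.

Lemma orlicz_normB f1 f2 : strongly_measurable f1 -> strongly_measurable f2 ->
  orlicz_norm phi M (f1 - f2)%R <= orlicz_norm phi M f1 + orlicz_norm phi M f2.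
Proof.
move=> sf1 sf2; apply: orlicz_norm_le; first by rewrite adde_ge0 ?orlicz_norm_ge0.
move=> g mu Mmu sg g1.
apply: (@le_trans _ _
  (\int[mu]_t ((rnorm (g t *: f1 t))%:E + (rnorm (g t *: f2 t))%:E))).
  apply: ge0_le_integral_nomeas => t _; first by rewrite lee_fin rnorm_ge0.
  rewrite -EFinD lee_fin scalerBr -[rnorm (g t *: f2 t)]rnormN.
  exact: rnormD.
rewrite ge0_integralD//; first by rewrite leeD// le_orlicz_norm.
- by move=> t _; rewrite lee_fin rnorm_ge0.
- exact: measurable_rnormZ.
- by move=> t _; rewrite lee_fin rnorm_ge0.
- exact: measurable_rnormZ.
Qed.

(** For a fixed test function and measure, Fatou's lemma bounds the integral for the limit by [c];
    the norm is a supremum of such integrals. *)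
Lemma orlicz_norm_fatou (f_ : nat -> T -> X) f (K : nat) c : 0 <= c ->
  (forall n, strongly_measurable (f_ n)) ->
  (forall t, f_ n t @[n --> \oo] --> f t) ->
  (forall n, (K <= n)%N -> orlicz_norm phi M (f_ n) <= c) ->
  orlicz_norm phi M f <= c.
Proof.
move=> c0 sf ff fc; apply: orlicz_norm_le => // g mu Mmu sg g1.
apply: (@fatou_le _ _ _ mu (fun n t => (rnorm (g t *: f_ n t))%:E) _ K).
- by move=> n; exact: measurable_rnormZ.
- by move=> n t; rewrite lee_fin rnorm_ge0.
- by move=> t; apply: cvg_EFin; [exact: nearW|apply: cvg_rnorm; exact: cvgZr].
- by move=> n Kn; apply: le_trans (fc n Kn); exact: le_orlicz_norm.
Qed.

(** An admissible [g] must vanish almost everywhere for each measure of [M], since [phi] of its norm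
    is infinite wherever it does not. *)
Lemma orlicz_norm_degenerate f :
  (forall c : R, (0 < c)%R -> phi c%:E = +oo) -> orlicz_norm phi M f = 0.
Proof.
move=> phioo; apply/eqP; rewrite eq_le orlicz_norm_ge0 andbT.
apply: orlicz_norm_le => // g mu Mmu sg g1.
have mg : measurable (g @^-1` ~` [set 0%R]) by exact: simple_function_preimage.
rewrite (@integral_eq_off_null _ _ _ mu _ _ (cst 0) mg) ?integral0//.
- apply: (@integral_pinfty_null _ _ _ mu _ (fun t => phi (rnorm (g t))%:E) mg) => [t|t /= gt0|].
  + by apply: (young_ge0 thetaphi); rewrite lee_fin rnorm_ge0.
  + by apply: phioo; apply: rnorm_gt0; apply/eqP.
  + apply: (@le_lt_trans _ _ 1); last exact: ltry.
    by apply: le_trans g1; apply: le_nnsup; exists mu.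
- by move=> t; rewrite lee_fin rnorm_ge0.
- by move=> t /= /contrapT ->; rewrite scale0r rnorm0.
Qed.

Lemma exists_admissible_function (E : set T) :
  (forall e : R, (0 < e)%R -> exists2 c : R, (0 < c)%R & phi c%:E <= e%:E) ->
  measurable E -> sup_measure M E < +oo ->
  exists g, [/\ simple_function g, M_phi phi M g <= 1 &
                forall t, E t -> g t != 0%R].
Proof.
move=> phi_small mE Eoo.
have Efin : sup_measure M E \is a fin_num by rewrite ge0_fin_numE// nnsup_ge0.
set m := fine (sup_measure M E).
have m0 : (0 <= m)%R by rewrite fine_ge0// nnsup_ge0.
have m1 : (0 < m + 1)%R by rewrite ltr_wpDl.
(* With this [c], the integral of [phi] of [c] times the indicator of [E] is at most [m / (m + 1)],
   hence at most 1. *)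
have [c c0 phic] := phi_small (m + 1)^-1%R ltac:(by rewrite invr_gt0).
exists (fun t => if t \in E then scalar_of_real c else 0%R); split.
- by apply: simple_function_if => //; exact: simple_function_cst.
- apply: nnsup_le => // _ [mu Mmu <-].
  apply: (@le_trans _ _ (\int[mu]_(t in E) cst ((m + 1)^-1)%:E t)).
    rewrite (integral_mkcond E); apply: ge0_le_integral_nomeas => t _.
      by apply: (young_ge0 thetaphi); rewrite lee_fin rnorm_ge0.
    rewrite patchE; case: ifPn => _; first by rewrite rnorm_scalar_of_real// ltW.
    by rewrite rnorm0 (young0 thetaphi).
  rewrite integral_cst//.
  apply: (@le_trans _ _ (((m + 1)^-1)%:E * m%:E)).
    apply: lee_wpmul2l; first by rewrite lee_fin invr_ge0 ltW.
    by rewrite fineK//; apply: le_nnsup; exists mu.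
  by rewrite -EFinM lee_fin mulrC ler_pdivrMr// mul1r lerDl.
- move=> t Et; rewrite mem_set//; apply/eqP => /(congr1 (@scalar_re R s)).
  by rewrite scalar_of_realK -scalar_of_real0 scalar_of_realK => /eqP; rewrite gt_eqF.
Qed.

(* The exceptional set is the same for all measures of the family, so no
   dominating measure is needed. *)
Lemma orlicz_summable_ae_cvg (f_ : nat -> T -> X) :
  (forall e : R, (0 < e)%R -> exists2 c : R, (0 < c)%R & phi c%:E <= e%:E) ->
  sigma_bounded M ->
  (forall n, strongly_measurable (f_ n)) ->
  \sum_(0 <= k <oo) orlicz_norm phi M (f_ k.+1 - f_ k)%R < +oo ->
  M_ae M (fun t => cvg (f_ n t @[n --> \oo])).
Proof.
move=> phi_small Mb sf fs.
have sB k : strongly_measurable (f_ k.+1 - f_ k)%R by exact: strongly_measurableB.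
pose w t := \sum_(0 <= k <oo) (rnorm (f_ k.+1 t - f_ k t)%R)%:E.
have w0 t : 0 <= w t.
  by apply: nneseries_ge0 => k _ _; rewrite lee_fin rnorm_ge0.
have mw : measurable_fun setT w.
  apply: (@ge0_emeasurable_sum _ _ _ _
    (fun k t => (rnorm (f_ k.+1 t - f_ k t)%R)%:E) xpredT).
    by move=> k t _ _; rewrite lee_fin rnorm_ge0.
  by move=> k _; apply/measurable_EFinP; exact: (strongly_measurable_rnorm (sB k)).
have mB : measurable (w @^-1` [set +oo]).
  by rewrite -[X in measurable X]setTI; apply: mw.
have [F [mF _ TF FM]] := Mb setT measurableT.
exists (w @^-1` [set +oo]); split=> //; last first.
  move=> t /= wt; apply: rnorm_summable_cvg.
  by rewrite -/(w t) ltey; apply/eqP.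
rewrite (_ : _ @^-1` _ = \bigcup_i (F i `&` w @^-1` [set +oo])); last first.
  by rewrite -setI_bigcupl -TF setTI.
apply: sup_measure_bigcup_eq0 => i; first exact: measurableI.
apply/sup_measure_eq0P => mu Mmu.
(* As [g] has no zero on [F i], weighting the series by the norm of [g] keeps it infinite where [w]
   is. Integrated termwise, the weighted series is at most the finite sum of Orlicz norms. *)
have [g [sg g1 gF]] := exists_admissible_function phi_small (mF i) (FM i).
apply: (@integral_pinfty_null _ _ _ mu _
  (fun t => \sum_(0 <= k <oo) (rnorm (g t *: (f_ k.+1 - f_ k)%R t))%:E)).
- exact: measurableI.
- by move=> t; apply: nneseries_ge0 => k _ _; rewrite lee_fin rnorm_ge0.
- move=> t [Ft /= wt]; transitivity ((rnorm (g t))%:E * w t).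
    rewrite -nneseriesZl; last by move=> k _; rewrite lee_fin rnorm_ge0.
    by apply: eq_eseriesr => k _; rewrite rnormZ EFinM.
  by rewrite wt gt0_muley// lte_fin rnorm_gt0// gF.
rewrite integral_nneseries//; last 2 first.
- by move=> k; exact: measurable_rnormZ.
- by move=> k t _; rewrite lee_fin rnorm_ge0.
apply: le_lt_trans fs; apply: lee_nneseries => k _.
  by move=> _; apply: integral_ge0 => t _; rewrite lee_fin rnorm_ge0.
exact: le_orlicz_norm.
Qed.

(** Setting [f] and its approximants to 0 on the exceptional set makes the convergence hold
    everywhere. *)
Lemma M_measurable_strongly f :
  M_measurable M f ->
  exists2 f' : T -> X, strongly_measurable f' & M_ae M (fun t => f t = f' t).
Proof.
move=> [h [sh [N [mN N0 hf]]]].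
exists (fun t => if t \in N then 0%R else f t); last first.
  by exists N; split=> // t Nt; rewrite memNset.
exists (fun n t => if t \in N then 0%R else h n t); split=> [n|t].
  by apply: simple_function_if => //; exact: simple_function_cst.
by case: ifPn => [_|]; [exact: cvg_cst|rewrite notin_setE; exact: hf].
Qed.

Lemma strongly_M_measurable f : strongly_measurable f -> M_measurable M f.
Proof.
move=> [h [sh hf]]; exists h; split=> //.
by exists set0; split=> //; apply/sup_measure_eq0P => mu _; exact: measure0.
Qed.

End orlicz_norm_theory.

(** * Completeness through an almost everywhere convergent subsequence *)

Theorem theorem2p1 (R : realType) (s : scalars)
  (X : completeNormedModType (scalar_field R s))
  (d : measure_display) (T : measurableType d)
  (M : set {measure set T -> \bar R}) (theta phi : \bar R -> \bar R)
  (hM : sigma_bounded M) (hphi : conjugate_young theta phi) :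
  complete_wrt (henstock_orlicz_space phi M : set (T -> X))
               (orlicz_norm phi M).
Proof.
move=> u uS uC.
have [phioo|phi_small] := young_dichotomy hphi.
  exists (fun=> 0).
    split; last by rewrite orlicz_norm_cst0 ltry.
    apply: strongly_M_measurable; apply: simple_strongly_measurable.
    exact: simple_function_cst.
  by move=> e e0; exists 0%N => n _; rewrite (orlicz_norm_degenerate M hphi).
have /choice[w wP] n : exists w : T -> X,
    strongly_measurable w /\ M_ae M (fun t => u n t = w t).
  by have [/M_measurable_strongly[w sw uw] _] := uS n; exists w.
have sw n : strongly_measurable (w n) by case: (wP n).
have uw n : M_ae M (fun t => u n t = w n t) by case: (wP n).
have /choice[N NP] k : exists N : nat, forall m n, (N <= m)%N -> (N <= n)%N ->
    (orlicz_norm phi M (u m - u n)%R < (1 / (2 ^ k.+1)%:R)%:E)%E.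
  by apply: uC; rewrite divr_gt0// ltr0n expn_gt0.
(* The sum puts both [r k] and [r k.+1] beyond the threshold [N k]; the summand [k] gives
   [k <= r k], so that [r] tends to infinity. *)
pose r k := (k + \sum_(i < k.+1) N i)%N.
have Nr j k : (j <= k)%N -> (N j <= r k)%N.
  rewrite -ltnS => jk; rewrite /r (bigD1 (Ordinal jk))//=.
  by rewrite addnCA leq_addr.
have wE m n : orlicz_norm phi M (w m - w n) = orlicz_norm phi M (u m - u n).
  apply: orlicz_norm_ae; have := M_ae_and (uw m) (uw n).
  by apply: M_ae_sub => t [mt nt]; rewrite !fctE mt nt.
have [||B [mB B0 wB]] := orlicz_summable_ae_cvg hphi phi_small hM
    (f_ := fun k => w (r k)).
- by move=> k.
- apply: (@le_lt_trans _ _ 1%E); last exact: ltry.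
  (* Successive distances are below [1 / 2 ^ k.+1], and these bounds sum to at most 1. *)
  apply: le_trans (epsilon_trick0 xpredT ler01).
  apply: lee_nneseries => k _; first by move=> _; exact: orlicz_norm_ge0.
  by rewrite wE; apply/ltW/NP; exact: Nr.
(* Zero on the common null set [B], so that the subsequence converges at every point. *)
pose z n t := if t \in B then 0 else w n t.
have sz n : strongly_measurable (z n).
  apply: strongly_measurable_if => //.
  exact/simple_strongly_measurable/simple_function_cst.
have uz n : M_ae M (fun t => u n t = z n t).
  have Bae : M_ae M (fun t => ~ B t) by exists B.
  apply: M_ae_sub (M_ae_and (uw n) Bae) => t [-> nBt].
  by rewrite /z memNset.
pose v t : X := lim (z (r k) t @[k --> \oo]).
have zv t : z (r k) t @[k --> \oo] --> v t.
  suff : cvg (z (r k) t @[k --> \oo]) by [].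
  rewrite /z; have [tB|tB] := boolP (t \in B); first exact: is_cvg_cst.
  by move: tB; rewrite notin_setE; exact: wB.
have sv : strongly_measurable v by exact: (strongly_measurable_cvg _ zv).
have uv n : M_ae M (fun t => (u n - v) t = (z n - v) t).
  by apply: M_ae_sub (uz n) => t unt; rewrite !fctE unt.
(* For fixed [n], the functions [z n - z (r k)] converge pointwise to [z n - v], and the Cauchy
   condition bounds their norms by [e] once [k >= K]; Fatou passes the bound to the limit. *)
have cvg_v e : 0 < e -> exists K : nat, forall n, (K <= n)%N ->
    (orlicz_norm phi M (u n - v)%R <= e%:E)%E.
  move=> e0; have [K KP] := uC e e0; exists K => n Kn.
  rewrite (orlicz_norm_ae phi (uv n)).
  apply: (@orlicz_norm_fatou _ _ _ _ _ _ _ (fun k => z n - z (r k)) _ K).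
  - by rewrite lee_fin ltW.
  - by move=> k; exact: strongly_measurableB.
  - by move=> t; apply: cvgB; [exact: cvg_cst|exact: zv].
  - move=> k Kk; rewrite (_ : orlicz_norm _ _ _ = orlicz_norm phi M (u n - u (r k))).
      by apply/ltW/KP => //; apply: leq_trans Kk _; exact: leq_addr.
    apply: orlicz_norm_ae; apply: M_ae_sub (M_ae_and (uz n) (uz (r k))).
    by move=> t [nt kt]; rewrite !fctE nt kt.
exists v; last first.
  (* The limit argument gives only a weak inequality; halving [e] restores the strict one. *)
  move=> e e0; have [K KP] := cvg_v (e / 2) (divr_gt0 e0 (ltr0Sn _ 1)).
  exists K => n /KP /le_lt_trans; apply.
  by rewrite lte_fin ltr_pdivrMr// mulr_natr mulr2n ltrDl.
split; first exact: strongly_M_measurable.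
have [K KP] := cvg_v 1 ltr01.
(* The norm of [v] is finite because [z K] agrees almost everywhere with [u K], a member of the
   space, and lies within distance 1 of [v]. *)
have -> : v = z K - (z K - v) by rewrite opprB subrKC.
apply: (le_lt_trans (orlicz_normB _ _ _ _)) => //.
  exact: strongly_measurableB.
rewrite lte_add_pinfty//.
  by rewrite -(orlicz_norm_ae phi (uz K)); case: (uS K).
by rewrite -(orlicz_norm_ae phi (uv K)) (le_lt_trans (KP K _))// ltry.
Qed.
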